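(* Write $q=p^a$ where $p$ is prime and $a$ is a positive integer, and let $\mathfrak{n}$ be a nilpotent $\mathbb{F}_q$-algebra. Then every supernormal subgroup $H$ of $U_\mathfrak{n}$ is an algebra group over the subfield $\mathbb{F}_p\subset\mathbb{F}_q$, in the sense that the set $\mathfrak{h}=\{X\in\mathfrak{n}:1+X\in H\}$ is a nilpotent $\mathbb{F}_p$-algebra.
   Context: $\mathbb{F}_q$ is a finite field; all $\mathbb{F}_q$-algebras are finite-dimensional and associative. For a nilpotent $\mathbb{F}_q$-algebra $\mathfrak{n}$, the algebra group is $U_\mathfrak{n}=\{1+X:X\in\mathfrak{n}\}$ with multiplication $(1+X)(1+Y)=1+X+Y+XY$. It acts on $\mathfrak{n}$ by $(1+X)Y=Y+XY$ and $Y(1+X)=Y+YX$. The superclass of $U_\mathfrak{n}$ containing $g$ is $\{1+x(g-1)y:x,y\in U_\mathfrak{n}\}$. A subgroup of $U_\mathfrak{n}$ is supernormal if it is a union of superclasses of $U_\mathfrak{n}$ (it is not assumed to come from an $\mathbb{F}_q$-subalgebra). *)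

(* Defs.v *)
From HB Require Import structures.
From mathcomp Require Import all_boot all_order all_algebra all_fingroup.

Set Implicit Arguments.
Unset Strict Implicit.
Unset Printing Implicit Defensive.

Import GRing.Theory VectorInternalTheory.
Local Open Scope ring_scope.

(* [A] is nilpotent for the product [mul]: for some [k], every product of
   [k.+1] elements of [A] vanishes. *)
Definition nilpotent_for (V : zmodType) (mul : V -> V -> V) (A : {pred V}) :=
  exists k : nat, forall (X : V) (s : seq V),
    X \in A -> {subset s <= A} -> size s = k -> foldl mul X s = 0.

(* Finite-dimensional nilpotent associative algebras, without unit (a nonzero nilpotent
   algebra has none), so that MathComp's [falgType] is not applicable. *)
HB.mixin Record Vector_isNilpotentAlgebra (K : fieldType) V of Vector K V := {
  amul : V -> V -> V;
  amulA : associative amul;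
  amulDl : left_distributive amul +%R;
  amulDr : right_distributive amul +%R;
  amulZl : forall (a : K) (x y : V), amul (a *: x) y = a *: amul x y;
  amulZr : forall (a : K) (x y : V), amul x (a *: y) = a *: amul x y;
  amul_nilpotent : nilpotent_for amul predT;
}.

#[short(type="nilpAlgType")]
HB.structure Definition NilpotentAlgebra (K : fieldType) :=
  {V of Vector K V & Vector_isNilpotentAlgebra K V}.

Fact nilpAlg_nilpotent (K : fieldType) (n : nilpAlgType K) :
  nilpotent_for (@amul K n) predT.
Proof. exact: amul_nilpotent. Qed.

Notation "X ** Y" := (amul X Y) (at level 40, left associativity) : ring_scope.

(* The element 1 + X of the algebra group is the formal expression
   [OnePlus X]. *)
Record algebra_group (F : finFieldType) (n : nilpAlgType F) : predArgType :=
  OnePlus { sub1 : n }.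

Section AlgebraGroup.
Variables (F : finFieldType) (n : nilpAlgType F).
Local Notation U := (algebra_group n).

Definition algebra_group_coord (g : U) := v2r (sub1 g).
Definition algebra_group_of_coord v : U := OnePlus (r2v v).

Fact algebra_group_coordK : cancel algebra_group_coord algebra_group_of_coord.
Proof.
by case=> X; rewrite /algebra_group_of_coord /algebra_group_coord v2rK.
Qed.

HB.instance Definition _ := Finite.copy U (can_type algebra_group_coordK).

Definition ag_one : U := OnePlus 0.
Definition ag_mul (g h : U) : U :=
  OnePlus (sub1 g + sub1 h + sub1 g ** sub1 h).
Definition ag_inv (g : U) : U := odflt ag_one [pick h | ag_mul h g == ag_one].

Lemma amul0r (X : n) : 0 ** X = 0.
Proof. by apply: (addrI (0 ** X)); rewrite -amulDl !addr0. Qed.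

Lemma amulr0 (X : n) : X ** 0 = 0.
Proof. by apply: (addrI (X ** 0)); rewrite -amulDr !addr0. Qed.

Lemma amulNr (X Y : n) : (- X) ** Y = - (X ** Y).
Proof. by apply: (addrI (X ** Y)); rewrite -amulDl !subrr amul0r. Qed.

Lemma amulrN (X Y : n) : X ** (- Y) = - (X ** Y).
Proof. by apply: (addrI (X ** Y)); rewrite -amulDr !subrr amulr0. Qed.

Fact ag_mulA : associative ag_mul.
Proof.
move=> [X] [Y] [Z]; congr OnePlus; rewrite /= !amulDl !amulDr amulA !addrA.
by rewrite [LHS](ACl (1*2*5*3*6*4*7)%AC).
Qed.

Fact ag_mul1g : left_id ag_one ag_mul.
Proof. by case=> X; congr OnePlus; rewrite /= amul0r addr0 add0r. Qed.

Fact ag_has_linv (g : U) : exists h, ag_mul h g == ag_one.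
Proof.
case: g => X; have [k nilk] := nilpAlg_nilpotent n.
have [Y Y0 YS] : exists2 Y : nat -> n, Y 0 = 0 &
    forall i, Y i.+1 = - X - Y i ** X.
  by exists (fun i => iter i (fun Y => - X - Y ** X) 0).
have DE i : Y i.+1 - Y i = iter i (amul^~ (- X)) (- X).
  elim: i => [|i IHi]; first by rewrite YS Y0 /= amul0r !subr0.
  rewrite [RHS]/= -IHi amulrN amulDl amulNr opprB.
  rewrite (YS i.+1) [in W in _ - W = _](YS i).
  by rewrite opprD addrACA subrr add0r opprK addrC.
exists (OnePlus (Y k)); apply/eqP; congr OnePlus.
have /eqP: Y k.+1 - Y k = 0.
  have foldE i W : foldl amul W (nseq i (- X)) = iter i (amul^~ (- X)) W.
    by elim: i W => //= i IHi W; rewrite IHi -iterSr.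
  by rewrite DE -foldE nilk ?size_nseq.
rewrite subr_eq0 /= => /eqP YE.
by rewrite -{1}YE YS addrAC addrNK addNr.
Qed.

Fact ag_mulVg : left_inverse ag_one ag_inv ag_mul.
Proof.
move=> g; rewrite /ag_inv; case: pickP => [h /eqP // | no_h].
by have [h hg] := ag_has_linv g; have := no_h h; rewrite hg.
Qed.

HB.instance Definition _ := Finite_isGroup.Build U ag_mulA ag_mul1g ag_mulVg.

Definition left_act (u : U) (Y : n) : n := Y + sub1 u ** Y.
Definition right_act (Y : n) (u : U) : n := Y + Y ** sub1 u.

Definition superclass (g : U) : {set U} :=
  [set OnePlus (left_act x (right_act (sub1 g) y)) | x : U, y : U].

Definition supernormal (H : {group U}) : Prop :=
  exists2 S : {set {set U}},
    {in S, forall C, exists g, C = superclass g} & H :=: cover S.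

Definition sub1_set (H : {group U}) : {pred n} := [pred X | OnePlus X \in H].

(* [h], with the operations of [n] and scalars restricted along
   the field embedding [iota : K -> F], is a finite-dimensional nilpotent
   K-algebra. Opposites are scalar multiples, and the axioms of associativity
   and bilinearity are inherited from [n]. *)
Record is_nilpotent_algebra (K : fieldType) (iota : K -> F) (h : {pred n}) :
    Prop := IsNilpotentAlgebra {
  nalg0 : 0 \in h;
  nalgD : {in h &, forall X Y, X + Y \in h};
  nalgZ : forall c : K, {in h, forall X, iota c *: X \in h};
  nalgM : {in h &, forall X Y, X ** Y \in h};
  nalg_findim : exists (m : nat) (b : 'I_m -> n),
    (forall i, b i \in h) /\
    {in h, forall X, exists c : 'I_m -> K, X = \sum_i iota (c i) *: b i};
  nalg_nilpotent : nilpotent_for (@amul F n) h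
}.

End AlgebraGroup.

(* The inclusion of the prime field when F has characteristic p. *)
Definition Fp_incl (F : finFieldType) (p : nat) (c : 'F_p) : F := (c : nat)%:R.

Fact Fp_inclD (F : finFieldType) (p : nat) :
  p \in [pchar F] -> {morph @Fp_incl F p : c d / c + d}.
Proof.
move=> pF c d; have p_pr := pcharf_prime pF.
rewrite /Fp_incl -natrD -[RHS](GRing.natr_mod_pchar pF) /=.
by congr (_ %% _)%:R; apply: Fp_cast.
Qed.

Fact Fp_inclM (F : finFieldType) (p : nat) :
  p \in [pchar F] -> {morph @Fp_incl F p : c d / c * d}.
Proof.
move=> pF c d; have p_pr := pcharf_prime pF.
rewrite /Fp_incl -natrM -[RHS](GRing.natr_mod_pchar pF) /=.
by congr (_ %% _)%:R; apply: Fp_cast.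
Qed.

Fact Fp_incl1 (F : finFieldType) (p : nat) :
  p \in [pchar F] -> @Fp_incl F p 1 = 1.
Proof. by []. Qed.

(* Main.v *)
Require Import Defs.
From mathcomp Require Import all_boot all_order all_algebra all_fingroup.

(** Let [h] be the set of all X such that 1 + X lies in H. Supernormality makes
    [h] stable under the left action of the algebra group. The group law of H
    gives X + Y + X Y = X + (1 + X) Y in [h] for X, Y in [h]; replacing Y by
    (1 + X)^-1 Y, which is again in [h], yields X + Y in [h]. Likewise, if
    1 + Y is the inverse of 1 + X, then X + (1 + X) Y = 0, so the opposite
    - X = (1 + X) Y is in [h]. Hence [h] is an additive group, and it contains
    X Y = (1 + X) Y - Y: it is even a left ideal. Everything else is formal:
    prime field scalars act by repeated addition, [h] is finite and thus spanned
    by its own elements, and nilpotency is inherited from the ambient algebra. *)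

Set Implicit Arguments.
Unset Strict Implicit.
Unset Printing Implicit Defensive.

Import GRing.Theory.
Local Open Scope ring_scope.

Section SupernormalSubgroups.
Variables (F : finFieldType) (n : nilpAlgType F).
Implicit Types (x y : algebra_group n) (X Y : n).

Lemma left_actM x y X : left_act (x * y)%g X = left_act x (left_act y X).
Proof.
by rewrite /left_act /= !amulDl !amulDr amulA !addrA [X + _ + _]addrAC.
Qed.

Lemma left_act1 X : left_act (1%g : algebra_group n) X = X.
Proof. by rewrite /left_act /= amul0r addr0. Qed.

Lemma sub1M x y : sub1 (x * y)%g = sub1 x + left_act x (sub1 y).
Proof. by rewrite /left_act addrA. Qed.

Variables (H : {group algebra_group n}) (snH : supernormal H).
Let h := sub1_set H.

Lemma mem_sub1_set x : (sub1 x \in h) = (x \in H).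
Proof. by case: x. Qed.

(** A superclass is an orbit of the two-sided action, so a union of
    superclasses is stable under each one-sided action. *)
Lemma sub1_set_left_act x X : X \in h -> left_act x X \in h.
Proof.
case: snH => S clS HE; rewrite !inE HE => /bigcupP[C SC].
have [g CE] := clS C SC; rewrite CE => /imset2P[u v _ _ [->]].
apply/bigcupP; exists C => //.
by rewrite -left_actM CE; apply: imset2_f.
Qed.

Lemma sub1_set0 : 0 \in h.
Proof. exact: group1. Qed.

(** X + Y is the coordinate of the group product (1 + X) (1 + (1 + X)^-1 Y). *)
Lemma sub1_setD : {in h &, forall X Y, X + Y \in h}.
Proof.
move=> X Y hX hY; pose x := OnePlus X.
have hY' : OnePlus (left_act x^-1%g Y) \in H by apply: sub1_set_left_act.
have := groupM (hX : x \in H) hY'.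
by rewrite -mem_sub1_set sub1M -left_actM mulgV left_act1.
Qed.

Lemma sub1_setN : {in h, forall X, - X \in h}.
Proof.
move=> X hX; pose x := OnePlus X.
have: sub1 (x * x^-1)%g = 0 by rewrite mulgV.
rewrite sub1M => /eqP; rewrite addrC addr_eq0 => /eqP <-.
by apply: sub1_set_left_act; rewrite mem_sub1_set groupV.
Qed.

Lemma sub1_setM X Y : Y \in h -> X ** Y \in h.
Proof.
move=> hY; rewrite -(addKr Y (X ** Y)); apply: sub1_setD.
  exact: sub1_setN.
exact: (sub1_set_left_act (OnePlus X)).
Qed.

Lemma sub1_setZ_nat k X : X \in h -> k%:R *: X \in h.
Proof.
move=> hX; rewrite scaler_nat; elim: k => [|k IHk]; first exact: sub1_set0.
by rewrite mulrS; apply: sub1_setD.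
Qed.

(** The spanning family is the whole finite set [h]; its elements are combined
    with the coefficients 0 and 1, which any embedding of fields preserves. *)
Lemma sub1_set_span (K : fieldType) (iota : K -> F) :
    iota 0 = 0 -> iota 1 = 1 ->
  exists (m : nat) (b : 'I_m -> n), (forall i, b i \in h) /\
    {in h, forall X, exists c : 'I_m -> K, X = \sum_i iota (c i) *: b i}.
Proof.
move=> iota0 iota1; exists #|H|, (fun i => sub1 (enum_val i)).
split=> [i | X hX]; first by rewrite mem_sub1_set enum_valP.
pose j := enum_rank_in hX (OnePlus X); exists (fun i => (i == j)%:R).
rewrite (bigD1 j) //= eqxx iota1 scale1r enum_rankK_in //=.
by rewrite big1 ?addr0 // => i /negPf->; rewrite iota0 scale0r.
Qed.

End SupernormalSubgroups.

Theorem proposition3p2 (F : finFieldType) (p a : nat) (p_prime : prime p)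
    (a_gt0 : (0 < a)%N) (cardF : #|F| = (p ^ a)%N) (n : nilpAlgType F)
    (H : {group algebra_group n}) (snH : supernormal H) :
  is_nilpotent_algebra (@Fp_incl F p) (sub1_set H).
Proof.
split.
- exact: sub1_set0.
- exact: sub1_setD.
- by move=> c X hX; apply: sub1_setZ_nat.
- by move=> X Y _ hY; apply: sub1_setM.
- exact: sub1_set_span.
- have [k nilk] := nilpAlg_nilpotent n.
  by exists k => X s _ _; apply: nilk.
Qed.
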